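(* Let $S$ be a set or multiset of positive integers, $b\in\mathbb{N}_0\cup\{\infty\}$ and $a\in\{1,2\}$. For all integers $m,n\ge0$ we have $p_{ab,S}(m,n)\ge p_{ab,S}(m+a,n)$, and $r_{ab,S}(m,n)>r_{ab,S}(m+a,n)$ provided $r_{ab,S}(m,n)\ne0$.
   Context: Each element of $S$ is assumed to have finite multiplicity. The numbers $p_{ab,S}(m,n)$ and $r_{ab,S}(m,n)$ are defined by the formal expansions $$\sum_{n\ge0}\sum_{m\in\mathbb{Z}}p_{ab,S}(m,n)z^mq^n=\prod_{\ell\in S}\frac{(1-q^{(3-a)\ell})(1-(zq^\ell)^{b+1})(1-(z^{-1}q^\ell)^{b+1})}{(1-q^\ell)(1-zq^\ell)(1-z^{-1}q^\ell)},$$ $$\sum_{n\ge0}\sum_{m\in\mathbb{Z}}r_{ab,S}(m,n)z^mq^n=\prod_{\ell\in S}\frac{(1-q^{(3-a)\ell})(1-(zq^\ell)^{b+1})(1-(z^{-1}q^\ell)^{b+1})}{(1-q^\ell)^2(1-zq^\ell)(1-z^{-1}q^\ell)},$$ where for $b=\infty$ the factors $(1-(zq^\ell)^{b+1})$, $(1-(z^{-1}q^\ell)^{b+1})$ are interpreted as $1$. *)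

(* Defs.v *)
From HB Require Import structures.
From mathcomp Require Import all_boot all_order all_algebra.
From mathcomp Require Import finmap boolp.
From mathcomp.multinomials Require Import monalg.

Set Implicit Arguments.
Unset Strict Implicit.
Unset Printing Implicit Defensive.

Import Order.TTheory GRing.Theory Num.Theory.

Local Open Scope fset.
Local Open Scope ring_scope.

(* Laurent polynomials in z over int: [f@_m] is the coefficient of z^m.
   [{malg int[int]}] supplies the finitely supported functions int -> int, but
   not the product, since monalg only multiplies over monoids in which 1 is the
   only invertible element. *)
Definition laurent : Type := {malg int[int]}.
HB.instance Definition _ := GRing.Zmodule.on laurent.

Definition zpow (i : int) : laurent := << 1 *g i >>.

Section LaurentRing.
Implicit Types f g h : laurent.

Definition lmul f g : laurent :=
  \sum_(i <- msupp f) \sum_(j <- msupp g) << f@_i * g@_j *g i + j >>.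

Lemma lmulw (d1 d2 : {fset int}) f g :
  msupp f `<=` d1 -> msupp g `<=` d2 ->
  lmul f g = \sum_(i <- d1) \sum_(j <- d2) << f@_i * g@_j *g i + j >>.
Proof.
move=> le1 le2; rewrite /lmul (big_fset_incl _ le1) /=.
  apply/eq_bigr=> i _; apply/big_fset_incl => // j _ /mcoeff_outdom ->.
  by rewrite mulr0 monalgU0.
move=> i _ /mcoeff_outdom fi.
by rewrite big1 => // j _; rewrite fi mul0r monalgU0.
Qed.

Lemma lmulC : commutative lmul.
Proof.
move=> f g; rewrite /lmul exchange_big; apply: eq_bigr => j _.
by apply: eq_bigr => i _; rewrite mulrC addrC.
Qed.

Lemma lmul0l : left_zero 0 lmul.
Proof. by move=> f; rewrite /lmul msupp0 big_seq_fset0. Qed.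

Lemma lmul0r : right_zero 0 lmul.
Proof. by move=> f; rewrite lmulC lmul0l. Qed.

Lemma lmulDl : left_distributive lmul +%R.
Proof.
move=> f g h; rewrite [in RHS](lmulw (fsubsetUl _ (msupp g)) (fsubset_refl _)).
rewrite [in RHS](lmulw (fsubsetUr (msupp f) _) (fsubset_refl _)).
rewrite (lmulw (msuppD_le f g) (fsubset_refl _)).
rewrite -big_split /=; apply/eq_bigr=> i _.
rewrite -big_split /=; apply/eq_bigr=> j _.
by rewrite mcoeffD mulrDl monalgUD.
Qed.

Lemma lmulDr : right_distributive lmul +%R.
Proof. by move=> f g h; rewrite lmulC lmulDl !(lmulC f). Qed.

Lemma lmulUU (c d i j : int) :
  lmul << c *g i >> << d *g j >> = << c * d *g i + j >>.
Proof. by rewrite (lmulw msuppU_le msuppU_le) !big_seq_fset1 !mcoeffUU. Qed.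

Lemma lmul_suml I (s : seq I) (F : I -> laurent) g :
  lmul (\sum_(i <- s) F i) g = \sum_(i <- s) lmul (F i) g.
Proof.
exact: (big_morph (lmul^~ g) (fun x y => lmulDl x y g) (lmul0l g)).
Qed.

Lemma lmul_sumr I (s : seq I) (F : I -> laurent) g :
  lmul g (\sum_(i <- s) F i) = \sum_(i <- s) lmul g (F i).
Proof. exact: (big_morph (lmul g) (lmulDr g) (lmul0r g)). Qed.

Lemma lmulA : associative lmul.
Proof.
move=> f g h; rewrite (monalgE f); set F := fun i => << f@_i *g i >>.
rewrite (lmul_suml _ F) (lmul_suml _ F) (lmul_suml _ (fun i => lmul (F i) g)).
apply: eq_bigr => i _; rewrite (monalgE g); set G := fun i => << g@_i *g i >>.
rewrite (lmul_suml _ G) (lmul_sumr _ G) (lmul_sumr _ (fun j => lmul (G j) h)).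
rewrite (lmul_suml _ (fun j => lmul (F i) (G j))); apply: eq_bigr => j _.
rewrite (monalgE h); set H := fun i => << h@_i *g i >>.
rewrite (lmul_sumr _ H) (lmul_sumr _ H) (lmul_sumr _ (fun k => lmul (G j) (H k))).
apply: eq_bigr => k _.
by rewrite !lmulUU mulrA addrA.
Qed.

Lemma lmul1l : left_id (zpow 0) lmul.
Proof.
move=> f; rewrite {1}(monalgE f) lmul_sumr [RHS]monalgE.
by apply: eq_bigr => i _; rewrite lmulUU mul1r add0r.
Qed.

Lemma lone_neq0 : zpow 0 != 0.
Proof. by rewrite monalgU_eq0. Qed.

HB.instance Definition _ := GRing.Zmodule_isComNzRing.Build laurent
  lmulA lmulC lmul1l lmulDl lone_neq0.

Lemma zpowD i j : zpow (i + j) = zpow i * zpow j.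
Proof. by rewrite -[RHS]/(lmul _ _) lmulUU mulr1. Qed.

Lemma zpow0 : zpow 0 = 1.
Proof. by []. Qed.

End LaurentRing.

Record fps (R : Type) := FPS { fcoef : nat -> R }.

HB.instance Definition _ (R : Type) := gen_eqMixin (fps R).
HB.instance Definition _ (R : Type) := gen_choiceMixin (fps R).

Section PowerSeries.
Context {R : comNzRingType}.
Implicit Types f g h : fps R.

Lemma fpsP f g : (forall n, fcoef f n = fcoef g n) -> f = g.
Proof. by case: f g => [f] [g] /= fg; congr FPS; apply/funext. Qed.

Definition fpsC (c : R) : fps R := FPS (fun n => c *+ (n == 0)%N).
Definition fpsX : fps R := FPS (fun n => (n == 1)%N%:R).

Definition fps_add f g : fps R := FPS (fun n => fcoef f n + fcoef g n).
Definition fps_opp f : fps R := FPS (fun n => - fcoef f n).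
Definition fps_mul f g : fps R :=
  FPS (fun n => \sum_(i < n.+1) fcoef f i * fcoef g (n - i)).

Let fps_addA : associative fps_add.
Proof. by move=> f g h; apply: fpsP => n; exact: addrA. Qed.
Let fps_addC : commutative fps_add.
Proof. by move=> f g; apply: fpsP => n; exact: addrC. Qed.
Let fps_add0 : left_id (FPS (fun=> 0)) fps_add.
Proof. by move=> f; apply: fpsP => n; exact: add0r. Qed.
Let fps_addN : left_inverse (FPS (fun=> 0)) fps_opp fps_add.
Proof. by move=> f; apply: fpsP => n; exact: addNr. Qed.

HB.instance Definition _ := GRing.isZmodule.Build (fps R)
  fps_addA fps_addC fps_add0 fps_addN.

Definition fps_trunc N f : {poly R} := \poly_(i < N.+1) fcoef f i.

Lemma fcoef_trunc N f n : (n <= N)%N -> fcoef f n = (fps_trunc N f)`_n.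
Proof. by move=> le_nN; rewrite coef_poly ltnS le_nN. Qed.

Lemma fps_mul_trunc N f g n : (n <= N)%N ->
  fcoef (fps_mul f g) n = (fps_trunc N f * fps_trunc N g)`_n.
Proof.
move=> le_nN; rewrite coefM; apply: eq_bigr => i _.
rewrite -!fcoef_trunc ?(leq_trans (leq_subr _ _)) //.
by rewrite (leq_trans _ le_nN) // -ltnS.
Qed.

Let fps_mulC : commutative fps_mul.
Proof.
by move=> f g; apply: fpsP => n; rewrite !(fps_mul_trunc _ _ (leqnn n)) mulrC.
Qed.

Let fps_mulA : associative fps_mul.
Proof.
move=> f g h; apply: fpsP => n.
have E (x y z : fps R) : fcoef (fps_mul x (fps_mul y z)) n =
    (fps_trunc n x * (fps_trunc n y * fps_trunc n z))`_n.
  rewrite (fps_mul_trunc _ _ (leqnn n)) [LHS]coefM [RHS]coefM.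
  apply: eq_bigr => i _; congr (_ * _).
  by rewrite -fcoef_trunc ?leq_subr // (fps_mul_trunc _ _ (leq_subr i n)).
by rewrite [in RHS]fps_mulC !E [fps_trunc n h * _]mulrC mulrA.
Qed.

Let fps_mul1 : left_id (fpsC 1) fps_mul.
Proof.
move=> f; apply: fpsP => n; rewrite /= big_ord_recl /= subn0 mulr1n mul1r.
by rewrite big1 ?addr0 // => i _; rewrite mulr0n mul0r.
Qed.

Let fps_mulDl : left_distributive fps_mul +%R.
Proof.
move=> f g h; apply: fpsP => n; rewrite /= -big_split.
by apply: eq_bigr => i _; rewrite mulrDl.
Qed.

Let fps1_neq0 : fpsC 1 != 0.
Proof. by apply/eqP => /(congr1 (fun f => fcoef f 0%N)) /eqP; rewrite /= oner_eq0. Qed.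

HB.instance Definition _ := GRing.Zmodule_isComNzRing.Build (fps R)
  fps_mulA fps_mulC fps_mul1 fps_mulDl fps1_neq0.

Definition fps_unit : pred (fps R) := fun f => `[< exists g, g * f = 1 >].
Definition fps_inv f : fps R :=
  if pselect (exists g, g * f = 1) is left ex then projT1 (cid ex) else f.

Let fps_mulV : {in fps_unit, left_inverse 1 fps_inv *%R}.
Proof.
move=> f /asboolP exg; rewrite /fps_inv.
by case: pselect => // ex; case: cid.
Qed.
Let fps_unitP f g : g * f = 1 -> fps_unit f.
Proof. by move=> gf; apply/asboolP; exists g. Qed.
Let fps_inv_out : {in [predC fps_unit], fps_inv =1 id}.
Proof.
move=> f /negP nf; rewrite /fps_inv; case: pselect => // ex.
by case: nf; apply/asboolP.
Qed.

HB.instance Definition _ := GRing.ComNzRing_hasMulInverse.Build (fps R)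
  fps_mulV fps_unitP fps_inv_out.

Lemma fcoefD f g n : fcoef (f + g) n = fcoef f n + fcoef g n.
Proof. by []. Qed.

Lemma fcoefN f n : fcoef (- f) n = - fcoef f n.
Proof. by []. Qed.

Lemma fcoefM f g n :
  fcoef (f * g) n = \sum_(i < n.+1) fcoef f i * fcoef g (n - i).
Proof. by []. Qed.

Lemma fcoef1 n : fcoef (1 : fps R) n = (n == 0)%N%:R.
Proof. by []. Qed.

Lemma fcoefXn k n : fcoef (fpsX ^+ k) n = (n == k)%:R.
Proof.
elim: k n => [|k IHk] n; first by rewrite expr0 fcoef1.
rewrite exprS fcoefM; case: n => [|n].
  by rewrite big_ord_recl big_ord0 /= mul0r addr0.
rewrite 2!big_ord_recl big1 /= ?mul0r ?add0r ?mul1r ?addr0.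
  by rewrite subn1 /= IHk eqSS.
by move=> i _; rewrite mul0r.
Qed.

Lemma fpsCM : {morph fpsC : c d / c * d}.
Proof.
move=> c d; apply: fpsP => n; rewrite fcoefM big_ord_recl big1 /=.
  by rewrite addr0 subn0 mulr1n mulrnAr.
by move=> i _; rewrite mulr0n mul0r.
Qed.

Fixpoint fps_inv_seq f n : seq R :=
  if n is n'.+1 then
    let s := fps_inv_seq f n' in
    rcons s ((n' == 0)%N%:R - \sum_(i < n') fcoef f (n' - i) * s`_i)
  else [::].

Lemma fps_unit1 f : fcoef f 0%N = 1 -> f \is a GRing.unit.
Proof.
move=> f0; have szs n : size (fps_inv_seq f n) = n.
  by elim: n => //= n IHn; rewrite size_rcons IHn.
have nths n i : (i < n)%N ->
    (fps_inv_seq f n)`_i = (fps_inv_seq f i.+1)`_i.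
  elim: n => // n IHn; rewrite ltnS leq_eqVlt => /predU1P[-> //|lt_in].
  by rewrite /= !nth_rcons !szs lt_in IHn // /= nth_rcons szs.
apply/asboolP; exists (FPS (fun n => (fps_inv_seq f n.+1)`_n)).
apply: fpsP => n; rewrite fcoefM fcoef1 big_ord_recr /= subnn f0 mulr1.
rewrite nth_rcons szs ltnn eqxx.
rewrite (eq_bigr (fun i : 'I_n => fcoef f (n - i) * (fps_inv_seq f n)`_i)).
  by rewrite addrC subrK.
by move=> i _; rewrite mulrC (nths n).
Qed.

(* f = 1 + O(q^l) *)
Definition fps_eq1_mod (l : nat) f :=
  forall k, (k < l)%N -> fcoef f k = (k == 0)%N%:R.

Lemma fps_eq1_mod1 l : fps_eq1_mod l 1.
Proof. by []. Qed.

Lemma fps_eq1_modM l f g :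
  fps_eq1_mod l f -> fps_eq1_mod l g -> fps_eq1_mod l (f * g).
Proof.
move=> f1 g1 k lt_kl; rewrite fcoefM big_ord_recr /= subnn.
rewrite f1 // g1 ?(leq_ltn_trans _ lt_kl) // mulr1 big1 ?add0r // => i _.
rewrite g1 ?(leq_ltn_trans (leq_subr _ _)) // subn_eq0 leqNgt ltn_ord.
by rewrite mulr0.
Qed.

Lemma fps_eq1_modX l f n : fps_eq1_mod l f -> fps_eq1_mod l (f ^+ n).
Proof.
move=> f1; elim: n => [|n IHn]; first exact: fps_eq1_mod1.
by rewrite exprS; apply: fps_eq1_modM.
Qed.

Lemma fps_eq1_modV l f : fps_eq1_mod l f -> fps_eq1_mod l f^-1.
Proof.
case: l => [//|l] f1 k lt_kl.
have Uf : f \is a GRing.unit by apply: fps_unit1; rewrite f1.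
have := congr1 (fun h => fcoef h k) (mulrV Uf).
rewrite fcoef1 fcoefM big_ord_recl f1 // subn0 mul1r big1 ?addr0 // => i _.
rewrite f1 ?mul0r // (leq_ltn_trans _ lt_kl) // -ltnS.
exact: (ltn_ord (lift ord0 i)).
Qed.

Lemma fps_eq1_modB f l k : (l <= k)%N -> fps_eq1_mod l (1 - f * fpsX ^+ k).
Proof.
move=> le_lk n lt_nl; rewrite fcoefD fcoefN fcoef1 fcoefM big1 ?subr0 // => i _.
rewrite fcoefXn ltn_eqF ?mulr0 //.
by rewrite (leq_ltn_trans (leq_subr _ _)) // (leq_trans lt_nl).
Qed.

(* The product of all F l, taken coefficientwise: the coefficient of q^n is read
   off from the factors with l <= n, which determine it when F l = 1 + O(q^l)
   (see [fps_prod_stable]). *)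
Definition fps_prod (F : nat -> fps R) : fps R :=
  FPS (fun n => fcoef (\prod_(l < n.+1) F l) n).

Lemma fps_prod_stable (F : nat -> fps R) n N :
  (forall l, fps_eq1_mod l (F l)) -> (n <= N)%N ->
  fcoef (\prod_(l < N.+1) F l) n = fcoef (fps_prod F) n.
Proof.
move=> F1; elim: N => [|N IHN]; first by rewrite leqn0 => /eqP->.
rewrite leq_eqVlt => /predU1P[-> //|le_nN]; rewrite -IHN //.
rewrite [\prod_(l < N.+2) _]big_ord_recr fcoefM.
rewrite [\sum_(i < n.+1) _]big_ord_recr /= subnn F1 // mulr1 big1 ?add0r //.
move=> i _; rewrite F1; last by rewrite ltnS (leq_trans (leq_subr _ _)).
by rewrite subn_eq0 leqNgt ltn_ord mulr0.
Qed.

End PowerSeries.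

Local Notation q := (fpsX : fps laurent).
Local Notation z := (fpsC (zpow 1) : fps laurent).

Lemma zV : z^-1 = fpsC (zpow (-1)).
Proof.
have zz : fpsC (zpow (-1)) * z = 1 by rewrite -fpsCM -zpowD addNr zpow0.
have Uz : z \is a GRing.unit by apply/asboolP; exists (fpsC (zpow (-1))).
by apply: (mulIr Uz); rewrite mulVr.
Qed.

(* [b = None] stands for b = infinity. *)
Definition bfactor (b : option nat) (x : fps laurent) : fps laurent :=
  if b is Some k then 1 - x ^+ k.+1 else 1.

Definition pfactor (a : nat) (b : option nat) (l : nat) : fps laurent :=
  (1 - q ^+ ((3 - a) * l)) * bfactor b (z * q ^+ l) * bfactor b (z^-1 * q ^+ l)
  / ((1 - q ^+ l) * (1 - z * q ^+ l) * (1 - z^-1 * q ^+ l)).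

Definition rfactor (a : nat) (b : option nat) (l : nat) : fps laurent :=
  (1 - q ^+ ((3 - a) * l)) * bfactor b (z * q ^+ l) * bfactor b (z^-1 * q ^+ l)
  / ((1 - q ^+ l) ^+ 2 * (1 - z * q ^+ l) * (1 - z^-1 * q ^+ l)).

Lemma eq1_modBq l k : (l <= k)%N -> fps_eq1_mod l (1 - q ^+ k).
Proof. by move=> le_lk; rewrite -[q ^+ k]mul1r; apply: fps_eq1_modB. Qed.

Lemma eq1_mod_bfactor b x l : fps_eq1_mod l (bfactor b (x * q ^+ l)).
Proof.
case: b => [k|]; last exact: fps_eq1_mod1.
by rewrite /= exprMn -exprM; apply: fps_eq1_modB; rewrite leq_pmulr.
Qed.

Lemma pfactor_eq1_mod a b l : (a <= 2)%N -> fps_eq1_mod l (pfactor a b l).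
Proof.
move=> a2; apply: fps_eq1_modM; last apply: fps_eq1_modV.
  do 2![apply: fps_eq1_modM; last exact: eq1_mod_bfactor].
  by apply: eq1_modBq; rewrite leq_pmull // subn_gt0.
do 2![apply: fps_eq1_modM; last exact: fps_eq1_modB].
exact: eq1_modBq.
Qed.

Lemma rfactor_eq1_mod a b l : (a <= 2)%N -> fps_eq1_mod l (rfactor a b l).
Proof.
move=> a2; apply: fps_eq1_modM; last apply: fps_eq1_modV.
  do 2![apply: fps_eq1_modM; last exact: eq1_mod_bfactor].
  by apply: eq1_modBq; rewrite leq_pmull // subn_gt0.
do 2![apply: fps_eq1_modM; last exact: fps_eq1_modB].
exact/fps_eq1_modX/eq1_modBq.
Qed.

(* S l is the multiplicity of l in the multiset S. *)
Definition pcoef (a : nat) (b : option nat) (S : nat -> nat) (m : int) (n : nat)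
    : int :=
  (fcoef (fps_prod (fun l => pfactor a b l ^+ S l)) n)@_m.

Definition rcoef (a : nat) (b : option nat) (S : nat -> nat) (m : int) (n : nat)
    : int :=
  (fcoef (fps_prod (fun l => rfactor a b l ^+ S l)) n)@_m.

Lemma pcoef_stable a b (S : nat -> nat) (m : int) n N :
  (a <= 2)%N -> (n <= N)%N ->
  (fcoef (\prod_(l < N.+1) pfactor a b l ^+ S l) n)@_m = pcoef a b S m n.
Proof.
move=> a2 le_nN.
rewrite (@fps_prod_stable _ (fun l => pfactor a b l ^+ S l)) // => l.
exact/fps_eq1_modX/pfactor_eq1_mod.
Qed.

Lemma rcoef_stable a b (S : nat -> nat) (m : int) n N :
  (a <= 2)%N -> (n <= N)%N ->
  (fcoef (\prod_(l < N.+1) rfactor a b l ^+ S l) n)@_m = rcoef a b S m n.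
Proof.
move=> a2 le_nN.
rewrite (@fps_prod_stable _ (fun l => rfactor a b l ^+ S l)) // => l.
exact/fps_eq1_modX/rfactor_eq1_mod.
Qed.

(* Main.v *)
(* A symmetric Laurent polynomial f satisfies f_m >= f_{m+a} for all m >= 0
   exactly when it is a nonnegative combination of the symmetric strings
   z^-c + z^(a-c) + ... + z^c.  For a = 1, 2 this class is closed under products:
   for symmetric f, g and D h(t) = h_t - h_{t+a},
     D(f g)(m) = sum_{t >= 0} (f_{m-t} - f_{m+a+t}) D g(t),
   and |m - t| and m + a + t agree modulo a.  The same identity shows that the
   property "f_m <> 0 implies f_m > f_{m+a}" is inherited by products.  So it
   suffices to treat a single factor, and there q^l may be replaced by q.  The
   q-coefficients of that factor are then strings for p; for r, the extra
   1/(1-q) turns them into their partial sums, and the term of index m already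
   contributes a strict decrease at m. *)
Require Import Defs.
From mathcomp Require Import all_boot all_order all_algebra.
From mathcomp Require Import finmap boolp.
From mathcomp.multinomials Require Import monalg.
From mathcomp Require Import zify ring.

Import Order.TTheory GRing.Theory Num.Theory.

Local Open Scope ring_scope.

(** * Coefficients of products of Laurent polynomials *)

Lemma mcoeff_sum I (r : seq I) (F : I -> laurent) (m : int) :
  (\sum_(i <- r) F i)@_m = \sum_(i <- r) (F i)@_m.
Proof. exact: (big_morph (mcoeff m) (mcoeffD m) (mcoeff0 m)). Qed.

Lemma mcoeff_mul_monom (f : laurent) (c j m : int) :
  (f * (<< c *g j >> : laurent))@_m = f@_(m - j) * c.
Proof.
rewrite -[_ * _]/(lmul _ _) (monalgE f); set F := fun i => << f@_i *g i >>.
rewrite (lmul_suml _ F) !mcoeff_sum mulr_suml; apply: eq_bigr => i _.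
rewrite /F lmulUU !mcoeffU mulrnAl; congr (_ *+ _); lia.
Qed.

Lemma laurent_bound (g : laurent) :
  exists N, forall t : int, (N <= `|t|)%N -> g@_t = 0.
Proof.
exists (\max_(i <- msupp g) `|i|%N).+1 => t le_Nt; apply: mcoeff_outdom.
apply/negP => g_t; move: le_Nt; rewrite ltnNge.
by rewrite (@leq_bigmax_seq _ _ xpredT (fun i : int => `|i|%N) _ g_t).
Qed.

(** The exponents of [g] are split into t >= 0 and -(t+1) < 0, so that both halves of the
    convolution are indexed by naturals. *)
Lemma mcoeff_mulE (f g : laurent) N (m : int) :
    (forall t : int, (N <= `|t|)%N -> g@_t = 0) ->
  (f * g)@_m = \sum_(t < N) f@_(m - t%:Z) * g@_t%:Z
             + \sum_(t < N) f@_(m + t.+1%:Z) * g@_(- t.+1%:Z).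
Proof.
move=> g0.
suff gE : g = (\sum_(t < N) (<< g@_t%:Z *g t%:Z >> : laurent)) +
         \sum_(t < N) (<< g@_(- t.+1%:Z) *g - t.+1%:Z >> : laurent).
  rewrite {1}gE mulrDr mcoeffD !mulr_sumr !mcoeff_sum.
  by congr (_ + _); apply: eq_bigr => t _; rewrite mcoeff_mul_monom ?opprK.
apply/malgP => j; rewrite mcoeffD !mcoeff_sum.
have [lt_jN|/g0 gj0] := ltnP `|j| N; last first.
  rewrite gj0 !big1 ?addr0 // => t _; rewrite mcoeffU.
    by case: eqP => // -> ; rewrite gj0.
  by case: eqP => // -> ; rewrite gj0.
have [j0|j0] := lerP 0 j.
  rewrite [X in _ + X]big1 ?addr0 => [|t _]; last first.
    by rewrite mcoeffU; case: eqP => //; lia.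
  rewrite (bigD1 (Ordinal lt_jN)) //= big1 ?addr0 => [|t].
    by rewrite mcoeffU gez0_abs // eqxx.
  by rewrite mcoeffU -val_eqE /=; case: eqP => //; lia.
have lt_j'N : (`|j|.-1 < N)%N by lia.
rewrite big1 ?add0r => [|t _]; last by rewrite mcoeffU; case: eqP => //; lia.
rewrite (bigD1 (Ordinal lt_j'N)) //= big1 ?addr0 => [|t].
  by rewrite mcoeffU (_ : - _ = j) ?eqxx //; lia.
by rewrite mcoeffU -val_eqE /=; case: eqP => //; lia.
Qed.

(** * Symmetric Laurent polynomials whose coefficients decrease in steps of a *)

Definition sym_laurent (f : laurent) := forall m : int, f@_(- m) = f@_m.

Lemma mcoeff_mul_sym (f g : laurent) N (m : int) : sym_laurent g ->
    (forall t : int, (N <= `|t|)%N -> g@_t = 0) ->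
  (f * g)@_m = f@_m * g@_0 +
    \sum_(t < N) (f@_(m - t.+1%:Z) + f@_(m + t.+1%:Z)) * g@_t.+1%:Z.
Proof.
(* With bound [N.+1] each sum has one term to spare: index 0 of the first becomes the central term,
   and the last of the second vanishes by [g0]. *)
move=> gsym g0; rewrite (mcoeff_mulE f g N.+1) => [|t ?]; last by apply: g0; lia.
rewrite big_ord_recl [X in _ + X]big_ord_recr /= (g0 (- _)); last by lia.
rewrite mulr0 addr0 subr0 -addrA -big_split /=; congr (_ + _).
by apply: eq_bigr => t _; rewrite gsym mulrDl.
Qed.

(** For a = 1 this is symmetry with unimodality; for a = 2, unimodality within each parity class of
    exponents. *)
Definition step_unimodal (a : nat) (f : laurent) :=
  sym_laurent f /\ forall m : nat, f@_(m + a)%:Z <= f@_m%:Z.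

Definition strict_step_unimodal (a : nat) (f : laurent) :=
  step_unimodal a f /\ forall m : nat, f@_m%:Z != 0 -> f@_(m + a)%:Z < f@_m%:Z.

(** Expanding both sides leaves a discrepancy equal to the sum over 0 < t < a of g_t (f_{m+t} -
    f_{m+a-t}). It is empty for a = 1, and for a = 2 its only term, t = 1, is zero. *)
Lemma step_diff_mul (a : nat) (f g : laurent) N (m : int) :
    a = 1%N \/ a = 2%N -> sym_laurent g ->
    (forall t : int, (N <= `|t|)%N -> g@_t = 0) ->
  (f * g)@_m - (f * g)@_(m + a%:Z) =
    \sum_(t < N) (f@_(m - t%:Z) - f@_(m + a%:Z + t%:Z))
                 * (g@_t%:Z - g@_(t + a)%:Z).
Proof.
move=> a12 gsym g0.
have shift (h : nat -> int) : h N = 0 ->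
    \sum_(t < N) h t = h 0%N + \sum_(t < N) h t.+1.
  by move=> hN; rewrite -(big_ord_recl N (fun t => h t)) big_ord_recr /= hN addr0.
have gN t : (N <= t)%N -> g@_t%:Z = 0 by move=> ?; apply: g0; lia.
have prodE (k : int) : (f * g)@_k = \sum_(t < N) f@_(k - t%:Z) * g@_t%:Z
    + \sum_(t < N) f@_(k + t.+1%:Z) * g@_t.+1%:Z.
  rewrite (mcoeff_mulE f g N) //; congr (_ + _).
  by apply: eq_bigr => t _; rewrite gsym.
have -> : \sum_(t < N) (f@_(m - t%:Z) - f@_(m + a%:Z + t%:Z))
                 * (g@_t%:Z - g@_(t + a)%:Z) =
    \sum_(t < N) f@_(m - t%:Z) * g@_t%:Z -
    \sum_(t < N) f@_(m - t%:Z) * g@_(t + a)%:Z -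
    \sum_(t < N) f@_(m + a%:Z + t%:Z) * g@_t%:Z +
    \sum_(t < N) f@_(m + a%:Z + t%:Z) * g@_(t + a)%:Z.
  by rewrite -!sumrB -big_split; apply: eq_bigr => t _ /=; ring.
rewrite !prodE.
have := shift (fun t => f@_(m + a%:Z - t%:Z) * g@_t%:Z).
have := shift (fun t => f@_(m + a%:Z + t%:Z) * g@_t%:Z).
rewrite /= gN // !mulr0 => -> // -> //.
case: a12 => ->.
  have -> : \sum_(t < N) f@_(m + 1%:Z - t.+1%:Z) * g@_t.+1%:Z =
      \sum_(t < N) f@_(m - t%:Z) * g@_(t + 1)%:Z.
    by apply: eq_bigr => t _; congr (f@_ _ * g@_ _); lia.
  have -> : \sum_(t < N) f@_(m + t.+1%:Z) * g@_t.+1%:Z =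
      \sum_(t < N) f@_(m + 1%:Z + t%:Z) * g@_(t + 1)%:Z.
    by apply: eq_bigr => t _; congr (f@_ _ * g@_ _); lia.
  by rewrite [m + 1%:Z - 0%:Z](_ : _ = m + 1%:Z + 0%:Z); [ring | lia].
have := shift (fun t => f@_(m + 2%:Z - t.+1%:Z) * g@_t.+1%:Z).
have := shift (fun t => f@_(m + t.+1%:Z) * g@_t.+1%:Z).
rewrite /= (gN N.+1) // !mulr0 => -> // -> //.
have -> : \sum_(t < N) f@_(m + 2%:Z - t.+2%:Z) * g@_t.+2%:Z =
    \sum_(t < N) f@_(m - t%:Z) * g@_(t + 2)%:Z.
  by apply: eq_bigr => t _; congr (f@_ _ * g@_ _); lia.
have -> : \sum_(t < N) f@_(m + t.+2%:Z) * g@_t.+2%:Z =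
    \sum_(t < N) f@_(m + 2%:Z + t%:Z) * g@_(t + 2)%:Z.
  by apply: eq_bigr => t _; congr (f@_ _ * g@_ _); lia.
rewrite (_ : m + 2%:Z - 1%:Z = m + 1%:Z); last by lia.
by rewrite [m + 2%:Z - 0%:Z](_ : _ = m + 2%:Z + 0%:Z); [ring | lia].
Qed.

Section StepUnimodal.
Context (a : nat) (a12 : a = 1%N \/ a = 2%N).
Implicit Types f g : laurent.

Lemma step_unimodal_le f (m k : nat) :
  step_unimodal a f -> f@_(m + k * a)%:Z <= f@_m%:Z.
Proof.
case=> _ fle; elim: k => [|k IHk]; first by rewrite mul0n addn0.
by rewrite mulSnr addnA; apply: le_trans IHk.
Qed.

Lemma step_unimodal_abs f (m : int) : step_unimodal a f -> f@_m = f@_`|m|%N%:Z.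
Proof.
case=> fsym _; have [m0|m0] := lerP 0 m; first by rewrite gez0_abs.
by rewrite -fsym; congr (f@_ _); lia.
Qed.

(** Going up from [|m|] in steps of a, the coefficients decrease until they leave the finite
    support, where they are 0. *)
Lemma step_unimodal_ge0 f (m : int) : step_unimodal a f -> 0 <= f@_m.
Proof.
move=> fW; rewrite step_unimodal_abs //; have [N fN] := laurent_bound f.
rewrite -(fN (`|m|%N + N * a)%N%:Z); first exact: step_unimodal_le.
by case: a12 => ->; lia.
Qed.

(** The index m + t exceeds |m - t| by 2 min(m, t), a multiple of a because a divides 2. *)
Lemma step_unimodal_far f (m t : nat) :
  step_unimodal a f -> f@_(m%:Z + a%:Z + t%:Z) <= f@_(`|m%:Z - t%:Z|%N + a)%:Z.
Proof.
move=> fW; have -> : m%:Z + a%:Z + t%:Z =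
    (`|m%:Z - t%:Z|%N + a + ((2 * minn m t) %/ a) * a)%N%:Z.
  by rewrite divnK; [lia | case: a12 => ->; rewrite ?dvd1n ?dvdn_mulr].
exact: step_unimodal_le.
Qed.

Lemma step_diff_ge0 f (m t : nat) : step_unimodal a f ->
  0 <= f@_(m%:Z - t%:Z) - f@_(m%:Z + a%:Z + t%:Z).
Proof.
move=> fW; rewrite subr_ge0 (le_trans (step_unimodal_far f m t fW)) //.
by rewrite [leRHS]step_unimodal_abs //; apply: (proj2 fW).
Qed.

(** For t < 0 the index m + |t| exceeds |m - |t|| by 2 min(m, |t|), again a multiple of a. This
    carries a nonzero term of a product at a negative t over to |t|, the only kind of index
    occurring in [step_diff_mul]. *)
Lemma step_unimodal_near f (m : nat) (t : int) :
  step_unimodal a f -> f@_(m%:Z - t) <= f@_`|m%:Z - `|t|%N%:Z|%N%:Z.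
Proof.
move=> fW; rewrite (step_unimodal_abs f (m%:Z - t)) //.
set x := `|m%:Z - `|t|%N%:Z|%N.
have -> : `|m%:Z - t|%N = (x + ((`|m%:Z - t|%N - x) %/ a) * a)%N.
  rewrite divnK; first by rewrite /x; lia.
  case: a12 => ->; rewrite ?dvd1n //.
  have [t0|t0] := lerP 0 t.
    by rewrite (_ : _ - _ = 0)%N // /x; lia.
  rewrite (_ : _ - _ = 2 * minn m `|t|)%N ?dvdn_mulr // /x; lia.
exact: step_unimodal_le.
Qed.

Lemma step_unimodalM f g :
  step_unimodal a f -> step_unimodal a g -> step_unimodal a (f * g).
Proof.
move=> fW gW; split=> m.
  have [[fsym _] [gsym _]] := (fW, gW); have [N gN] := laurent_bound g.
  rewrite !(mcoeff_mul_sym f g N) // fsym; congr (_ + _).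
  apply: eq_bigr => t _; congr (_ * _); rewrite addrC.
  by congr (_ + _); rewrite -fsym; congr (f@_ _); lia.
have [N gN] := laurent_bound g.
rewrite -subr_ge0 PoszD (step_diff_mul a f g N) //; last exact: (proj1 gW).
apply: sumr_ge0 => t _; apply: mulr_ge0; first exact: step_diff_ge0.
by rewrite subr_ge0; exact: (proj2 gW).
Qed.

Lemma strict_step_unimodalM f g :
  strict_step_unimodal a f -> strict_step_unimodal a g ->
  strict_step_unimodal a (f * g).
Proof.
move=> [fW fG] [gW gG]; split=> [|m fg_m]; first exact: step_unimodalM.
have [N gN] := laurent_bound g.
have [t ft gt] : exists2 t : int, f@_(m%:Z - t) != 0 & g@_t != 0.
  have [//|none] := pselect (exists2 t : int, f@_(m%:Z - t) != 0 & g@_t != 0).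
  case/eqP: fg_m; rewrite (mcoeff_mulE f g N) // !big1 ?addr0 // => t _.
    apply/eqP/negPn/negP; rewrite mulf_eq0 negb_or => /andP[ft gt].
    by apply: none; exists (- t.+1%:Z); rewrite ?opprK.
  apply/eqP/negPn/negP; rewrite mulf_eq0 negb_or => /andP[ft gt].
  by apply: none; exists t%:Z.
have lt_tN : (`|t| < N)%N by rewrite ltnNge; apply: contra gt => /gN->.
rewrite -subr_gt0 PoszD (step_diff_mul a f g N) //; last exact: (proj1 gW).
(* The term of index |t| is strictly positive: [gG] at |t| handles the factor from g, and [fG] at |m
   - |t|| the factor from f. *)
rewrite (bigD1 (Ordinal lt_tN)) //=.
apply: ltr_pwDl; last first.
  apply: sumr_ge0 => s _; apply: mulr_ge0; first exact: step_diff_ge0.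
  by rewrite subr_ge0; exact: (proj2 gW).
apply: mulr_gt0; rewrite subr_gt0; last first.
  by apply: gG; rewrite -step_unimodal_abs.
apply: le_lt_trans (step_unimodal_far f m _ fW) _.
rewrite [ltRHS]step_unimodal_abs //; apply: fG.
apply: contra ft => /eqP f0; rewrite eq_le step_unimodal_ge0 // andbT -f0.
exact: step_unimodal_near.
Qed.

End StepUnimodal.

Lemma step_unimodal0 a : step_unimodal a 0.
Proof. by split=> m; rewrite !mcoeff0. Qed.

Lemma step_unimodalD a (f g : laurent) :
  step_unimodal a f -> step_unimodal a g -> step_unimodal a (f + g).
Proof.
move=> [fsym fle] [gsym gle]; split=> m; rewrite !mcoeffD.
  by rewrite fsym gsym.
exact: lerD.
Qed.

Lemma strict_step_unimodal0 a : strict_step_unimodal a 0.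
Proof. by split=> [|m]; [exact: step_unimodal0 | rewrite mcoeff0 eqxx]. Qed.

Lemma strict_step_unimodalD a (f g : laurent) :
  strict_step_unimodal a f -> strict_step_unimodal a g ->
  strict_step_unimodal a (f + g).
Proof.
move=> [fW fG] [gW gG]; split=> [|m]; first exact: step_unimodalD.
rewrite !mcoeffD => fg_m; have [fm0|/fG fm] := eqVneq f@_m%:Z 0.
  apply: ler_ltD; first exact: (proj2 fW).
  by apply: gG; apply: contra fg_m => /eqP->; rewrite fm0.
exact: ltr_leD fm (proj2 gW m).
Qed.

Lemma mcoeff1 (m : int) : (1 : laurent)@_m = (m == 0)%:R.
Proof. by rewrite -[1]/(<< 1 *g 0 >> : laurent) mcoeffU eq_sym. Qed.

Lemma strict_step_unimodal1 a : (0 < a)%N -> strict_step_unimodal a 1.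
Proof.
move=> a0; have lt0 (m : nat) : (1 : laurent)@_(m + a)%:Z = 0.
  by rewrite mcoeff1; case: eqP => //; lia.
split=> [|m]; last by rewrite lt0 mcoeff1; case: (m%:Z == 0).
split=> m; first by rewrite !mcoeff1 oppr_eq0.
by rewrite lt0 mcoeff1 ler0n.
Qed.

(** * Properties of power series that hold coefficient by coefficient *)

Definition coefwise {R : Type} (P : R -> Prop) (f : fps R) :=
  forall n, P (fcoef f n).

Section Coefwise.
Context {R : comNzRingType} (P : R -> Prop).
Hypotheses (P0 : P 0) (P1 : P 1).
Hypotheses (PD : forall x y, P x -> P y -> P (x + y)).
Hypotheses (PM : forall x y, P x -> P y -> P (x * y)).

Lemma coefwise1 : coefwise P (1 : fps R).
Proof. by move=> n; rewrite fcoef1; case: (n == 0)%N. Qed.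

Lemma coefwiseM (f g : fps R) : coefwise P f -> coefwise P g -> coefwise P (f * g).
Proof. by move=> fP gP n; rewrite fcoefM; apply: big_ind => // i _; apply: PM. Qed.

Lemma coefwiseX (f : fps R) k : coefwise P f -> coefwise P (f ^+ k).
Proof.
move=> fP; elim: k => [|k IHk]; first exact: coefwise1.
by rewrite exprS; apply: coefwiseM.
Qed.

Lemma coefwise_fps_prod (F : nat -> fps R) :
  (forall l, coefwise P (F l)) -> coefwise P (fps_prod F).
Proof.
move=> FP n; suff prodP : coefwise P (\prod_(l < n.+1) F l) by apply: prodP.
apply: (big_ind (coefwise P)) => //.
- exact: coefwise1.
- exact: coefwiseM.
Qed.

End Coefwise.

(** * Dilation of power series, reducing the factor of index l to one independent of l *)

Section Dilation.
Context {R : comNzRingType} (l : nat) (l_gt0 : (0 < l)%N).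
Implicit Types f g : fps R.

(* The substitution q -> q^l. *)
Definition fps_dil f : fps R :=
  FPS (fun n => if (l %| n)%N then fcoef f (n %/ l) else 0).

(** On truncations the dilation is composition with X^l, so its multiplicativity is inherited from
    polynomials. *)
Lemma fcoef_dil N f n : (n <= N)%N ->
  fcoef (fps_dil f) n = (fps_trunc N f \Po 'X^l)`_n.
Proof.
move=> le_nN; rewrite coef_comp_poly_Xn //=; case: ifP => // _.
by apply: fcoef_trunc; rewrite (leq_trans (leq_div _ _)).
Qed.

Lemma fps_dilB : {morph fps_dil : f g / f - g}.
Proof.
move=> f g; apply: fpsP => n; rewrite fcoefD fcoefN /=.
by case: ifP => // _; rewrite subr0.
Qed.

Lemma fps_dilM : {morph fps_dil : f g / f * g}.
Proof.
move=> f g; apply: fpsP => n.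
transitivity (((fps_trunc n f \Po 'X^l) * (fps_trunc n g \Po 'X^l))`_n).
  rewrite -rmorphM /= coef_comp_poly_Xn //; case: ifP => // _.
  exact: fps_mul_trunc (leq_div _ _).
rewrite coefM fcoefM; apply: eq_bigr => i _.
by rewrite -!fcoef_dil ?leq_subr // -ltnS.
Qed.

Lemma fps_dilC c : fps_dil (fpsC c) = fpsC c.
Proof.
apply: fpsP => n /=; case: ifP => [/dvdnP[k ->]|].
  by rewrite mulnK // muln_eq0 (gtn_eqF l_gt0) orbF.
by case: n; rewrite ?dvdn0.
Qed.

Lemma fps_dil1 : fps_dil 1 = 1.
Proof. exact: fps_dilC. Qed.

Lemma fps_dilXn f k : fps_dil (f ^+ k) = fps_dil f ^+ k.
Proof.
elim: k => [|k IHk]; first exact: fps_dil1.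
by rewrite !exprS fps_dilM IHk.
Qed.

Lemma fps_dilX : fps_dil fpsX = fpsX ^+ l.
Proof.
apply: fpsP => n; rewrite fcoefXn /=; case: ifP => [/dvdnP[k ->]|].
  by rewrite mulnK // -{2}[l]mul1n eqn_pmul2r.
by case: eqP => // ->; rewrite dvdnn.
Qed.

Lemma fps_dil_1subX f k : fps_dil (1 - f ^+ k) = 1 - fps_dil f ^+ k.
Proof. by rewrite fps_dilB fps_dil1 fps_dilXn. Qed.

Lemma fps_dilCX c : fps_dil (fpsC c * fpsX) = fpsC c * fpsX ^+ l.
Proof. by rewrite fps_dilM fps_dilC fps_dilX. Qed.

Lemma coefwise_dil (P : R -> Prop) f :
  P 0 -> coefwise P f -> coefwise P (fps_dil f).
Proof. by move=> P0 fP n /=; case: ifP. Qed.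

End Dilation.

(** * The factors as dilated products of geometric series *)

Definition le_bound (b : option nat) (n : nat) : bool :=
  if b is Some k then (n <= k)%N else true.

(* The expansion of (1 - (c q)^(b+1)) / (1 - c q), or 1 / (1 - c q) if b = None. *)
Definition geom {R : comNzRingType} (c : R) (b : option nat) : fps R :=
  FPS (fun n => if le_bound b n then c ^+ n else 0).

Lemma fcoefCXM {R : comNzRingType} (c : R) (f : fps R) n :
  fcoef (fpsC c * fpsX * f) n = if n is n'.+1 then c * fcoef f n' else 0.
Proof.
have CX k : fcoef (fpsC c * fpsX) k = c * (k == 1)%:R.
  rewrite fcoefM big_ord_recl big1 /= => [|i _]; last by rewrite mul0r.
  by rewrite addr0 subn0.
rewrite fcoefM big_ord_recl CX mulr0 mul0r add0r.
case: n => [|n]; first by rewrite big_ord0.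
rewrite big_ord_recl CX mulr1 big1 ?addr0 ?subn1 // => i _.
by rewrite CX mulr0 mul0r.
Qed.

(** Telescoping: c^n and c c^(n-1) cancel in degree n, except for the first in degree 0 and, when b
    = k, the second in degree k+1. *)
Lemma geomP (c : laurent) b :
  (1 - fpsC c * fpsX) * geom c b = bfactor b (fpsC c * fpsX).
Proof.
have pow k : (fpsC c * fpsX) ^+ k = fpsC (c ^+ k) * fpsX ^+ k.
  rewrite exprMn; congr (_ * _); elim: k => [|k IHk].
    by apply: fpsP => n; rewrite !expr0 fcoef1 /=; case: n.
  by rewrite !exprS IHk fpsCM.
apply: fpsP => n; rewrite mulrBl mul1r fcoefD fcoefN fcoefCXM.
have -> : fcoef (bfactor b (fpsC c * fpsX)) n =
    (n == 0)%N%:R - (if b is Some k then c ^+ n *+ (n == k.+1) else 0).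
  case: b => [k|]; last by rewrite subr0 fcoef1.
  rewrite /bfactor fcoefD fcoefN fcoef1 pow fcoefM big_ord_recl big1 /=.
    rewrite addr0 subn0 fcoefXn mulr1n; congr (_ - _).
    by case: eqP => [->|]; rewrite ?mulr1 ?mulr0.
  by move=> i _; rewrite mul0r.
case: n b => [|n] [k|]; rewrite /= ?expr0 ?subr0 //.
  rewrite eqSS exprS.
  by case: ltngtP; rewrite ?mulr1n ?mulr0n ?mulr0 ?subrr ?subr0 ?sub0r.
by rewrite exprS subrr.
Qed.

Local Notation q := (fpsX : fps laurent).

(* [pfactor a b 1], using (1 - q^(3-a)) / (1 - q) = 1 + ... + q^(2-a). *)
Definition pbase (a : nat) (b : option nat) : fps laurent :=
  geom 1 (Some (2 - a)%N) * (geom (zpow 1) b * geom (zpow (-1)) b).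

Lemma fpsC1 : fpsC (1 : laurent) = 1.
Proof. by apply: fpsP => n; rewrite fcoef1; case: n. Qed.

Lemma bfactor_dil l (l_gt0 : (0 < l)%N) b c :
  bfactor b (fpsC c * q ^+ l) = fps_dil l (bfactor b (fpsC c * q)).
Proof.
case: b => [k|]; last by rewrite /bfactor (fps_dil1 l l_gt0).
by rewrite /bfactor (fps_dil_1subX l l_gt0) (fps_dilCX l l_gt0).
Qed.

Lemma geom_dil l (l_gt0 : (0 < l)%N) b c :
  (1 - fpsC c * q ^+ l) * fps_dil l (geom c b) = bfactor b (fpsC c * q ^+ l).
Proof.
rewrite bfactor_dil // -geomP (fps_dilM l l_gt0) -(fps_dilCX l l_gt0).
by rewrite -[fpsC c * q in RHS]expr1 (fps_dil_1subX l l_gt0) expr1.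
Qed.

Lemma one_subCX_unit l c : (0 < l)%N -> 1 - fpsC c * q ^+ l \is a GRing.unit.
Proof. by move=> l_gt0; apply: fps_unit1; rewrite (fps_eq1_modB _ (leqnn l)). Qed.

Lemma geom1_dil l (l_gt0 : (0 < l)%N) k :
  (1 - q ^+ l) * fps_dil l (geom 1 (Some k)) = 1 - q ^+ (k.+1 * l).
Proof.
have := geom_dil l l_gt0 (Some k) 1.
by rewrite /bfactor fpsC1 mul1r -exprM mulnC.
Qed.

Lemma geom1_dil_inf l (l_gt0 : (0 < l)%N) :
  (1 - q ^+ l) * fps_dil l (geom 1 None) = 1.
Proof. by have := geom_dil l l_gt0 None 1; rewrite fpsC1 mul1r. Qed.

(** Identifies a quotient with a product of known expansions g_i from the division-free relations
    d_i g_i = n_i. *)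
Lemma frac_of_factors (A : comUnitRingType) (d1 d2 d3 g1 g2 g3 n1 n2 n3 : A) :
    d1 \is a GRing.unit -> d2 \is a GRing.unit -> d3 \is a GRing.unit ->
    d1 * g1 = n1 -> d2 * g2 = n2 -> d3 * g3 = n3 ->
  n1 * n2 * n3 / (d1 * d2 * d3) = g1 * (g2 * g3).
Proof.
move=> U1 U2 U3 <- <- <-; apply: (canLR (mulrK _)); first by rewrite !unitrM U1 U2.
ring.
Qed.

(* [pfactor] alone would be the prime factor constructor of prime.v. *)
Lemma pfactorE a b l : (0 < l)%N -> (a <= 2)%N ->
  Defs.pfactor a b l = fps_dil l (pbase a b).
Proof.
move=> l_gt0 a2; rewrite /Defs.pfactor zV /pbase !(fps_dilM l l_gt0).
apply: frac_of_factors.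
- by have := one_subCX_unit l 1 l_gt0; rewrite fpsC1 mul1r.
- exact: one_subCX_unit.
- exact: one_subCX_unit.
- by rewrite (subSn a2); exact: geom1_dil.
- exact: geom_dil.
- exact: geom_dil.
Qed.

Lemma rfactorE a b l : (0 < l)%N -> (a <= 2)%N ->
  rfactor a b l = fps_dil l (pbase a b * geom 1 None).
Proof.
move=> l_gt0 a2; rewrite /rfactor zV /pbase !(fps_dilM l l_gt0).
have U1 : 1 - q ^+ l \is a GRing.unit.
  by have := one_subCX_unit l 1 l_gt0; rewrite fpsC1 mul1r.
(* The extra series 1/(1 - q^l) is grouped with the first geometric factor, so that d1 is the square
   (1 - q^l)^2. *)
rewrite [RHS]mulrAC; apply: frac_of_factors.
- by rewrite unitrX.
- exact: one_subCX_unit.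
- exact: one_subCX_unit.
- rewrite expr2 mulrACA (geom1_dil_inf l l_gt0) mulr1 (subSn a2); exact: geom1_dil.
- exact: geom_dil.
- exact: geom_dil.
Qed.

(** * Coefficients of a single factor *)

(* z^m q^s occurs, as (z q)^i (q/z)^(s-i) with i, s - i <= b. *)
Definition string_mem (b : option nat) (s : nat) (m : int) : bool :=
  [&& (`|m| <= s)%N, ~~ odd (s + `|m|) & le_bound b (s + `|m|)./2].

Lemma zpowXn (c : int) n : zpow c ^+ n = zpow (c * n%:Z).
Proof.
elim: n => [|n IHn]; first by rewrite expr0 mulr0.
by rewrite exprS IHn -zpowD; congr zpow; lia.
Qed.

(** The product of (z q)^i and (q/z)^(s-i) has z-exponent 2i - s, so only i = (s + m)/2 can
    contribute; the larger of i and s - i is then (s + |m|)/2, which is what b has to bound. *)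
Lemma mcoeff_geom_geom b s (m : int) :
  (fcoef (geom (zpow 1) b * geom (zpow (-1)) b) s)@_m = (string_mem b s m)%:R.
Proof.
rewrite fcoefM mcoeff_sum.
have termE (i : 'I_s.+1) :
    (fcoef (geom (zpow 1) b) i * fcoef (geom (zpow (-1)) b) (s - i))@_m =
    [&& le_bound b i, le_bound b (s - i) & (i%:Z *+ 2 == s%:Z + m)]%:R.
  rewrite /geom /=.
  case: (le_bound b i); last by rewrite mul0r mcoeff0.
  case: (le_bound b (s - i)); last by rewrite mulr0 mcoeff0.
  rewrite !zpowXn -zpowD mcoeffU; congr (_ *+ _).
  by have := ltn_ord i; case: eqP; case: eqP => //; lia.
rewrite (eq_bigr _ (fun i _ => termE i)).
have [/andP[le_ms ev]|out] := boolP ((`|m| <= s)%N && ~~ odd (s + `|m|)); last first.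
  rewrite /string_mem andbA (negbTE out) big1 // => i _.
  by case: eqP; rewrite ?andbF //; have := ltn_ord i; lia.
have [i0 i0E] : exists i0 : 'I_s.+1, i0%:Z *+ 2 = s%:Z + m.
  have lt_i0 : ((`|(s%:Z + m)%R|%N)./2 < s.+1)%N by lia.
  by exists (Ordinal lt_i0) => /=; lia.
rewrite (bigD1 i0) //= big1 => [|i ne_i]; last first.
  by case: eqP; rewrite ?andbF // => ?; case/eqP: ne_i; apply: val_inj => /=; lia.
rewrite addr0 i0E eqxx andbT /string_mem le_ms ev /=; congr (nat_of_bool _)%:R.
have := ltn_ord i0; case: b {termE} => [k|] //=; lia.
Qed.

Lemma mcoeff_pbase1 b s (m : int) : (fcoef (pbase 1 b) s)@_m =
  (string_mem b s m)%:R + (if s is s'.+1 then (string_mem b s' m)%:R else 0).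
Proof.
have g1 : geom (1 : laurent) (Some 1%N) = 1 + fpsC 1 * fpsX.
  rewrite fpsC1 mul1r; apply: fpsP => -[|[|n]]; rewrite fcoefD fcoef1 /=.
  - by rewrite addr0.
  - by rewrite expr1 add0r.
  - by rewrite addr0.
rewrite /pbase g1 mulrDl mul1r fcoefD mcoeffD fcoefCXM mcoeff_geom_geom.
by case: s => [|s]; rewrite ?mcoeff0 // mul1r mcoeff_geom_geom.
Qed.

Lemma mcoeff_pbase2 b s (m : int) :
  (fcoef (pbase 2 b) s)@_m = (string_mem b s m)%:R.
Proof.
have g1 : geom (1 : laurent) (Some 0%N) = 1.
  by apply: fpsP => -[|n]; rewrite fcoef1 /= ?expr0.
by rewrite /pbase g1 mul1r mcoeff_geom_geom.
Qed.

Lemma string_memN b s m : string_mem b s (- m) = string_mem b s m.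
Proof. by rewrite /string_mem abszN. Qed.

(** For a = 2 the coefficient of q^s is a single string, constant on one parity class up to a
    cutoff. For a = 1 the strings of s and s - 1 have opposite parities and together fill an
    interval centred at 0. *)
Lemma step_unimodal_pbase a b :
  a = 1%N \/ a = 2%N -> coefwise (step_unimodal a) (pbase a b).
Proof.
case=> -> s; split=> m; rewrite ?mcoeff_pbase1 ?mcoeff_pbase2 ?string_memN //.
- by case: s => [|s]; rewrite ?string_memN.
- case: s => [|s]; rewrite /string_mem; case: b => [k|] /=; lia.
- rewrite /string_mem; case: b => [k|] /=; lia.
Qed.

(** In q-degree m the exponents of z stop at m, so z^m has coefficient 1 and z^(m+a) coefficient 0.
    If b is finite, the occurrence of z^m in some degree t forces m <= b, which makes z^m present in
    degree m. *)
Lemma pbase_supp a b t (m : nat) : a = 1%N \/ a = 2%N ->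
    (fcoef (pbase a b) t)@_m%:Z != 0 ->
  (m <= t)%N /\ (fcoef (pbase a b) m)@_(m + a)%:Z < (fcoef (pbase a b) m)@_m%:Z.
Proof.
case=> ->; rewrite ?mcoeff_pbase1 ?mcoeff_pbase2 /string_mem.
  case: t m b => [|t] [|m] [k|] /=; lia.
case: b => [k|] /=; lia.
Qed.

Lemma fcoef_geom1 (f : fps laurent) s :
  fcoef (f * geom 1 None) s = \sum_(t < s.+1) fcoef f t.
Proof. by rewrite fcoefM; apply: eq_bigr => t _; rewrite /= expr1n mulr1. Qed.

Lemma strict_step_unimodal_rbase a b : a = 1%N \/ a = 2%N ->
  coefwise (strict_step_unimodal a) (pbase a b * geom 1 None).
Proof.
move=> a12 s; have W := step_unimodal_pbase a b a12.
rewrite fcoef_geom1; split=> [|m].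
  apply: big_ind => [|f g|t _]; [exact: step_unimodal0 | exact: step_unimodalD |].
  exact: W.
rewrite !mcoeff_sum => sum_m.
have [t t_m] : exists t : 'I_s.+1, (fcoef (pbase a b) t)@_m%:Z != 0.
  apply/existsP; rewrite -[X in is_true X]negbK; apply/negP => /existsPn zero.
  by case/eqP: sum_m; apply: big1 => t _; apply/eqP/negPn/zero.
have [le_mt lt_m] := pbase_supp a b t m a12 t_m.
have lt_ms : (m < s.+1)%N by rewrite (leq_ltn_trans le_mt).
rewrite (bigD1 (Ordinal lt_ms)) //= [ltRHS](bigD1 (Ordinal lt_ms)) //=.
apply: ltr_leD => //; apply: ler_sum => i _; exact: (proj2 (W i)).
Qed.

(** * From single factors to the infinite products *)

Theorem theorem3p5 (S : nat -> nat) (b : option nat) (a : nat)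
  (S0 : S 0%N = 0%N) (a12 : a = 1%N \/ a = 2%N) (m n : nat) :
  pcoef a b S m%:Z n >= pcoef a b S (m + a)%N%:Z n /\
  (rcoef a b S m%:Z n <> 0 -> rcoef a b S m%:Z n > rcoef a b S (m + a)%N%:Z n).
Proof.
have [a_gt0 a_le2] : (0 < a)%N /\ (a <= 2)%N by case: a12 => ->.
have G0 := strict_step_unimodal0 a; have G1 := strict_step_unimodal1 a a_gt0.
have GD := strict_step_unimodalD a; have GM := strict_step_unimodalM a a12.
have W0 := step_unimodal0 a; have W1 := proj1 G1.
have WD := step_unimodalD a; have WM := step_unimodalM a a12.
split; rewrite /pcoef /rcoef.
  set F := fun l => Defs.pfactor a b l ^+ S l.
  suff [] : step_unimodal a (fcoef (fps_prod F) n) by [].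
  (* Dilation requires l > 0; at l = 0 the factor is 1, since [S0] gives it exponent 0. *)
  apply: (coefwise_fps_prod _ W0 W1 WD WM) => l; rewrite {}/F; case: (posnP l) => [->|l_gt0].
    by rewrite S0 expr0; apply: coefwise1.
  apply: (coefwiseX _ W0 W1 WD WM); rewrite pfactorE //.
  by apply: coefwise_dil => //; apply: step_unimodal_pbase.
set F := fun l => rfactor a b l ^+ S l.
suff [_ lt_m] : strict_step_unimodal a (fcoef (fps_prod F) n).
  by move=> /eqP; apply: lt_m.
apply: (coefwise_fps_prod _ G0 G1 GD GM) => l; rewrite {}/F; case: (posnP l) => [->|l_gt0].
  by rewrite S0 expr0; apply: coefwise1.
apply: (coefwiseX _ G0 G1 GD GM); rewrite rfactorE //.
by apply: coefwise_dil => //; apply: strict_step_unimodal_rbase.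
Qed.
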